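(* Fix the data $d,\mu,h_0,T,L,f,u_0$ as in the context. There exists a constant $C>0$, independent of $n$, $\Delta t$ and $\Delta z$, such that for all positive integers $M,N$ with $\Delta t=T/N<\frac1{2L}$, the solution $\{W_j^n\}$ of the finite difference scheme (S1) described in the context satisfies $$\|W^n\|\le C\,\|W^0\|,\qquad 1\le n\le N.$$
   Context: Data: $d,\mu,h_0,T,L$ are positive constants; $f:\mathbb{R}\to\mathbb{R}$ is differentiable and satisfies $-Lu\le f(u)\le Lu$ and $|f'(u)|\le L$ for all $u\ge 0$. The initial function satisfies $u_0\in C^2([0,h_0])$, $u_0'(0)=0$, $u_0(h_0)=0$, and $u_0(x)>0$ for $0\le x<h_0$. Mesh: $M,N$ are positive integers, $\Delta z=1/M$, $\Delta t=T/N$, $z_j=j\Delta z$ for $0\le j\le M$. Difference operators: $\delta_t U_j^n=\frac{U_j^n-U_j^{n-1}}{\Delta t}$, $\delta_t Q^n=\frac{Q^n-Q^{n-1}}{\Delta t}$, $\delta_z U_{j+\frac12}^n=\frac{U_{j+1}^n-U_j^n}{\Delta z}$, $\delta_z^2U_0^n=\frac{2}{\Delta z}\delta_zU_{\frac12}^n$, and $\delta_z^2U_j^n=\frac1{\Delta z}\bigl(\delta_zU_{j+\frac12}^n-\delta_zU_{j-\frac12}^n\bigr)$ for $1\le j\le M-1$. Scheme (S1) (a discretization of the reaction-diffusion problem $u_t=du_{xx}+f(u)$ on $0<x<h(t)$, $u_x(t,0)=0$, $u(t,h(t))=0$, $h'(t)=-\mu u_x(t,h(t))$, $h(0)=h_0$,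 $u(0,x)=u_0(x)$, after the change of variables $z=x/h(t)$, $w(t,z)=u(t,x)$, $r=h^2$; $W_j^n$ approximates $w(t_n,z_j)$ and $R^n$ approximates $r(t_n)$, where $t_n=n\Delta t$): the initial values are $R^0=h_0^2$ and $W_j^0=u_0(z_jh_0)$, $0\le j\le M$, and for $1\le n\le N$ $$R^n\delta_tW_0^n-d\,\delta_z^2W_0^n=R^nf(W_0^{n-1}),$$ $$R^n\delta_tW_j^n-\frac{z_j\,\delta_tR^n}{2}\,\delta_zW_{j+\frac12}^n-d\,\delta_z^2W_j^n=R^nf(W_j^{n-1}),\quad 1\le j\le M-1,$$ $$\delta_tR^n=-2\mu\,\delta_zW_{M-\frac12}^{n-1},\qquad W_M^n=0.$$ Norm: on $V_1=\{(v_j)_{0\le j\le M}: v_M=0\}$, $(u,v)=\Delta z\bigl(\tfrac12u_0v_0+\sum_{j=1}^{M-1}u_jv_j\bigr)$ and $\|u\|=\sqrt{(u,u)}$. $W^n$ denotes $(W_j^n)_{0\le j\le M}$. *)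

(* Defs.v *)
From Stdlib Require Import Reals.
From Coquelicot Require Import Coquelicot.
Open Scope R_scope.

Definition Icc (a b : R) : R -> Prop := fun x => a <= x <= b.

(* [D_in u u' D x] is the derivative relative to [D], hence one-sided at the
   endpoints; values of [u] outside [a, b] play no role. *)
Definition C2_on (a b : R) (u : R -> R) : Prop :=
  exists u' u'' : R -> R, forall x, Icc a b x ->
    D_in u u' (Icc a b) x /\
    D_in u' u'' (Icc a b) x /\
    continue_in u'' (Icc a b) x.

(* Grid functions are indexed by all of [nat]; entries with index beyond M
   (resp. time levels beyond N) are never read. *)

Definition mesh (M : nat) : R := 1 / INR M.
Definition tstep (T : R) (N : nat) : R := T / INR N.
Definition node (M j : nat) : R := INR j * mesh M.

Definition delta_t (dt : R) (Q : nat -> R) (n : nat) : R :=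
  (Q n - Q (n - 1)%nat) / dt.

(* [delta_z dz U j] is the difference quotient at the half-node j + 1/2. *)
Definition delta_z (dz : R) (U : nat -> R) (j : nat) : R :=
  (U (j + 1)%nat - U j) / dz.

Definition delta_z2 (dz : R) (U : nat -> R) (j : nat) : R :=
  match j with
  | O => 2 / dz * delta_z dz U 0
  | S k => 1 / dz * (delta_z dz U (S k) - delta_z dz U k)
  end.

(* [W n j] stands for W_j^n and [Rr n] for R^n. *)
Record scheme_S1 (d mu h0 T : R) (f u0 : R -> R) (M N : nat)
    (W : nat -> nat -> R) (Rr : nat -> R) : Prop := {
  S1_R0 : Rr 0%nat = h0 ^ 2;
  S1_W0 : forall j, (j <= M)%nat -> W 0%nat j = u0 (node M j * h0);
  S1_left : forall n, (1 <= n <= N)%nat ->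
    Rr n * delta_t (tstep T N) (fun m => W m 0%nat) n
      - d * delta_z2 (mesh M) (W n) 0
    = Rr n * f (W (n - 1)%nat 0%nat);
  S1_inner : forall n j, (1 <= n <= N)%nat -> (1 <= j <= M - 1)%nat ->
    Rr n * delta_t (tstep T N) (fun m => W m j) n
      - node M j * delta_t (tstep T N) Rr n / 2 * delta_z (mesh M) (W n) j
      - d * delta_z2 (mesh M) (W n) j
    = Rr n * f (W (n - 1)%nat j);
  S1_front : forall n, (1 <= n <= N)%nat ->
    delta_t (tstep T N) Rr n
    = - 2 * mu * delta_z (mesh M) (W (n - 1)%nat) (M - 1);
  S1_right : forall n, (1 <= n <= N)%nat -> W n M = 0
}.

(* The sum is empty when M = 1, since then the range is 1 <= j <= 0. *)
Definition inner1 (M : nat) (u v : nat -> R) : R :=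
  mesh M * (1 / 2 * (u 0%nat * v 0%nat)
            + sum_n_m (fun j => u j * v j) 1 (M - 1)).

Definition norm1 (M : nat) (u : nat -> R) : R := sqrt (inner1 M u u).

(* Main.v *)
Require Import Defs.
From Stdlib Require Import Reals Lra Lia Psatz.
From Coquelicot Require Import Coquelicot.
Open Scope R_scope.

(** The scheme satisfies a discrete minimum principle and a discrete energy
    inequality, and the two together give a growth factor [1 + L dt] per step.

    Nonnegativity.  If [W^(n-1) >= 0], the front equation makes [R] nondecreasing,
    so the convection velocity has the sign for which the forward difference is
    the upwind one.  At a node [j < M] where [W^n] is minimal both the convection
    and the diffusion terms are nonnegative, hence [W^n_j >= W^(n-1)_j + dt f(W^(n-1)_j)
    >= (1 - L dt) W^(n-1)_j >= 0] ([nonneg_step]).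

    Energy.  Test the scheme with [W^n].  Summation by parts makes the diffusion
    term dissipative ([diffusion_dissipative]).  The upwind convection term is
    dissipative too ([convection_dissipative]): up to a square of the right sign
    it is [z (w^2)_z / 2], which integrates to minus half of the integral of
    [w^2], and its coefficient [delta_t R] is nonnegative.  What remains is
    [(W^n, W^n) <= (W^(n-1) + dt f(W^(n-1)), W^n) <= (1 + L dt) (W^(n-1), W^n)],
    where the last step needs [W^(n-1)] and [W^n] nonnegative because [f] is only
    controlled there.  Young's inequality turns this into
    [norm W^n <= (1 + L dt) norm W^(n-1)] ([energy_step]).

    Iterating, [(1 + L T / N)^n <= exp (L T)], which is the constant. *)

(** * Trapezoidal sums *)

(** The trapezoidal weights in units of the mesh, so that
    [inner1 M u v] is [mesh M * trap (M - 1) (u * v)] by conversion. *)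
Definition trap (k : nat) (g : nat -> R) : R :=
  1 / 2 * g 0%nat + sum_n_m g 1 k.

Lemma trap_0 g : trap 0 g = 1 / 2 * g 0%nat.
Proof.
unfold trap; rewrite sum_n_m_zero; [unfold zero; simpl; lra | lia].
Qed.

Lemma trap_S k g : trap (S k) g = trap k g + g (S k).
Proof.
unfold trap; rewrite sum_n_Sm; [unfold plus; simpl; lra | lia].
Qed.

Lemma trap_le k g h :
  (forall j, (j <= k)%nat -> g j <= h j) -> trap k g <= trap k h.
Proof.
induction k as [|k IH]; intros H.
- rewrite !trap_0; specialize (H 0%nat (le_n _)); lra.
- rewrite !trap_S.
  assert (H1 := H (S k) (le_n _)).
  assert (trap k g <= trap k h) by (apply IH; intros j Hj; apply H; lia).
  lra.
Qed.

Lemma trap_plus k g h : trap k (fun j => g j + h j) = trap k g + trap k h.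
Proof. induction k as [|k IH]; rewrite ?trap_0, ?trap_S; lra. Qed.

Lemma trap_scal k c g : trap k (fun j => c * g j) = c * trap k g.
Proof. induction k as [|k IH]; rewrite ?trap_0, ?trap_S, ?IH; lra. Qed.

Lemma trap_nonneg k g : (forall j, (j <= k)%nat -> 0 <= g j) -> 0 <= trap k g.
Proof.
intros H.
assert (E : trap k (fun j => 0 * g j) <= trap k g).
{ apply trap_le; intros j Hj; specialize (H j Hj); lra. }
rewrite trap_scal in E; lra.
Qed.

(** * Dissipativity of diffusion and upwind convection *)

(** Summation by parts with the boundary term at the right end kept, so that it
    can be proved by induction; the defect is [dz] times a sum of squares of
    difference quotients.  The factor 2 in [delta_z2 dz U 0] (reflection at the
    Neumann end) cancels the half weight of the trapezoidal sum. *)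
Lemma diffusion_dissipative dz U k : 0 < dz ->
  dz * trap k (fun j => delta_z2 dz U j * U j) <= delta_z dz U k * U (k + 1)%nat.
Proof.
intros Hdz.
(* Moving the boundary factor one node to the right costs a square. *)
assert (Hsq : forall j, delta_z dz U j * U j <= delta_z dz U j * U (j + 1)%nat).
{ intros j.
  assert (E : U (j + 1)%nat = U j + dz * delta_z dz U j)
    by (unfold delta_z; field; lra).
  rewrite E; assert (H := Rle_0_sqr (delta_z dz U j)); unfold Rsqr in H; nra. }
induction k as [|k IH].
- rewrite trap_0; simpl delta_z2.
  replace (dz * _) with (delta_z dz U 0 * U 0%nat) by (field; lra).
  apply Hsq.
- rewrite trap_S; simpl delta_z2.
  replace (k + 1)%nat with (S k) in IH by lia.
  apply Rle_trans with (2 := Hsq (S k)).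
  replace (dz * _) with (dz * trap k (fun j => delta_z2 dz U j * U j)
     + (delta_z dz U (S k) - delta_z dz U k) * U (S k)) by (field; lra).
  lra.
Qed.

(** The forward difference satisfies [U_j (U_(j+1) - U_j) <= (U_(j+1)^2 - U_j^2) / 2],
    and summation by parts moves the difference onto the increasing weight [j]. *)
Lemma convection_dissipative U k :
  trap k (fun j => INR j * ((U (j + 1)%nat - U j) * U j))
  <= INR k * (U (k + 1)%nat) ^ 2 / 2.
Proof.
induction k as [|k IH].
- rewrite trap_0; simpl; lra.
- rewrite trap_S, S_INR.
  replace (k + 1)%nat with (S k) in IH by lia.
  assert (Hk := pos_INR k).
  set (a := U (S k + 1)%nat); set (b := U (S k)) in *.
  assert (0 <= (INR k + 1) * (a - b) ^ 2) by (apply Rmult_le_pos; [lra | apply pow2_ge_0]).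
  assert (Hb := pow2_ge_0 b).
  nra.
Qed.

(** * Differences at a minimum of a grid function *)

Lemma exists_argmin (U : nat -> R) M :
  exists j, (j <= M)%nat /\ forall i, (i <= M)%nat -> U j <= U i.
Proof.
induction M as [|M [j [Hj H]]].
- exists 0%nat; split; [lia|]; intros i Hi; replace i with 0%nat by lia; lra.
- destruct (Rle_dec (U j) (U (S M))) as [Hle | Hgt].
  + exists j; split; [lia|]; intros i Hi.
    destruct (Nat.eq_dec i (S M)) as [-> | Hne]; [exact Hle | apply H; lia].
  + exists (S M); split; [lia|]; intros i Hi.
    destruct (Nat.eq_dec i (S M)) as [-> | Hne]; [lra|].
    assert (U j <= U i) by (apply H; lia); lra.
Qed.

Lemma delta_z_argmin_nonneg dz U M j : 0 < dz -> (j < M)%nat ->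
  (forall i, (i <= M)%nat -> U j <= U i) -> 0 <= delta_z dz U j.
Proof.
intros Hdz Hj H; unfold delta_z.
apply Rdiv_le_0_compat; [|exact Hdz].
assert (U j <= U (j + 1)%nat) by (apply H; lia); lra.
Qed.

Lemma delta_z2_argmin_nonneg dz U M j : 0 < dz -> (j < M)%nat ->
  (forall i, (i <= M)%nat -> U j <= U i) -> 0 <= delta_z2 dz U j.
Proof.
intros Hdz Hj H.
assert (H1 := delta_z_argmin_nonneg dz U M j Hdz Hj H).
assert (Hc : 0 < 1 / dz) by (apply Rdiv_lt_0_compat; lra).
destruct j as [|k]; simpl; apply Rmult_le_pos.
- unfold Rdiv in *; lra.
- exact H1.
- lra.
- assert (delta_z dz U k <= 0); [|lra].
  unfold delta_z; replace (k + 1)%nat with (S k) by lia.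
  assert (U (S k) <= U k) by (apply H; lia).
  unfold Rdiv in *; nra.
Qed.

(** * One step of the scheme *)

(** One time step from [V] to [U], with [r] for [R^n] and [D] for [delta_t R].
    The equation at [j = 0] has the form of the interior ones because the
    convection coefficient [node M 0] vanishes. *)
Definition step_eq (d dt r D : R) (f : R -> R) (M : nat) (V U : nat -> R) : Prop :=
  forall j, (j < M)%nat ->
    r * ((U j - V j) / dt) - node M j * D / 2 * delta_z (mesh M) U j
      - d * delta_z2 (mesh M) U j
    = r * f (V j).

Section OneStep.

Variables (d dt r D L : R) (f : R -> R) (M : nat) (V U : nat -> R).
Hypothesis hd : 0 < d.
Hypothesis hdt : 0 < dt.
Hypothesis hr : 0 < r.
Hypothesis hD : 0 <= D.
Hypothesis hL : 0 < L.
Hypothesis hM : (0 < M)%nat.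
Hypothesis hf : forall u, 0 <= u -> - L * u <= f u <= L * u.
Hypothesis hV : forall j, (j <= M)%nat -> 0 <= V j.
Hypothesis hstep : step_eq d dt r D f M V U.
Hypothesis hUM : U M = 0.

Lemma mesh_pos : 0 < mesh M.
Proof. unfold mesh; apply Rdiv_lt_0_compat; [lra | apply lt_0_INR; exact hM]. Qed.

Lemma node_nonneg j : 0 <= node M j.
Proof.
unfold node; apply Rmult_le_pos; [apply pos_INR | apply Rlt_le, mesh_pos].
Qed.

Lemma step_solved j : (j < M)%nat ->
  U j = V j + dt * f (V j)
        + dt / r * (D / 2 * (node M j * delta_z (mesh M) U j)
                    + d * delta_z2 (mesh M) U j).
Proof.
intros Hj; assert (E := hstep j Hj).
replace (U j) with (V j + dt / r * (r * ((U j - V j) / dt))) at 1 by (field; lra).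
replace (r * ((U j - V j) / dt)) with
  (r * f (V j) + (D / 2 * (node M j * delta_z (mesh M) U j)
                  + d * delta_z2 (mesh M) U j)) by (rewrite <- E; field; lra).
field; lra.
Qed.

(** Discrete minimum principle: at a minimum of [U] the difference terms in
    [step_solved] only help, and [L dt <= 1] keeps the explicit reaction from
    overshooting zero. *)
Lemma nonneg_step : L * dt <= 1 -> forall j, (j <= M)%nat -> 0 <= U j.
Proof.
intros hLdt.
destruct (exists_argmin U M) as [j [Hj Hmin]].
intros i Hi; apply Rle_trans with (2 := Hmin i Hi).
destruct (Nat.eq_dec j M) as [-> | Hne]; [lra|].
assert (HjM : (j < M)%nat) by lia.
assert (H1 := delta_z_argmin_nonneg (mesh M) U M j mesh_pos HjM Hmin).
assert (H2 := delta_z2_argmin_nonneg (mesh M) U M j mesh_pos HjM Hmin).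
assert (H3 := node_nonneg j).
assert (HV := hV j Hj); destruct (hf (V j) HV) as [Hf _].
assert (HR : 0 <= V j + dt * f (V j)) by nra.
assert (HQ : 0 <= dt / r * (D / 2 * (node M j * delta_z (mesh M) U j)
                            + d * delta_z2 (mesh M) U j)).
{ apply Rmult_le_pos.
  - apply Rlt_le, Rdiv_lt_0_compat; assumption.
  - assert (0 <= D / 2 * (node M j * delta_z (mesh M) U j)).
    { apply Rmult_le_pos; [lra | apply Rmult_le_pos; assumption]. }
    assert (0 <= d * delta_z2 (mesh M) U j) by (apply Rmult_le_pos; lra).
    lra. }
rewrite (step_solved j HjM); lra.
Qed.

(** Testing [step_solved] with [U] and Young's inequality
    [(1 + L dt) V U <= ((1 + L dt)^2 V^2 + U^2) / 2]; half of [U^2] is absorbed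
    on the left. *)
Lemma energy_step : (forall j, (j <= M)%nat -> 0 <= U j) ->
  inner1 M U U <= (1 + L * dt) ^ 2 * inner1 M V V.
Proof.
intros hU.
set (g := 1 + L * dt).
change (mesh M * trap (M - 1) (fun j => U j * U j)
        <= g ^ 2 * (mesh M * trap (M - 1) (fun j => V j * V j))).
set (diff := trap (M - 1) (fun j => delta_z2 (mesh M) U j * U j)).
set (conv := trap (M - 1) (fun j => INR j * ((U (j + 1)%nat - U j) * U j))).
assert (Hm := mesh_pos).
assert (Hdiff : diff <= 0).
{ assert (H := diffusion_dissipative (mesh M) U (M - 1) Hm).
  replace (M - 1 + 1)%nat with M in H by lia.
  rewrite hUM, Rmult_0_r in H; fold diff in H; nra. }
assert (Hconv : conv <= 0).
{ assert (H := convection_dissipative U (M - 1)).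
  replace (M - 1 + 1)%nat with M in H by lia.
  rewrite hUM in H; fold conv in H.
  replace (INR (M - 1) * 0 ^ 2 / 2) with 0 in H by field; exact H. }
assert (Hsum : trap (M - 1) (fun j => U j * U j) <=
  trap (M - 1) (fun j => g ^ 2 / 2 * (V j * V j) + (1 / 2 * (U j * U j)
     + (dt / r * (D / 2) * (INR j * ((U (j + 1)%nat - U j) * U j))
        + dt / r * d * (delta_z2 (mesh M) U j * U j))))).
{ apply trap_le; intros j Hj.
  assert (HV : 0 <= V j) by (apply hV; lia).
  assert (HU : 0 <= U j) by (apply hU; lia).
  destruct (hf (V j) HV) as [_ Hf].
  assert (Hz : node M j * delta_z (mesh M) U j = INR j * (U (j + 1)%nat - U j))
    by (unfold node, delta_z; field; lra).
  assert (E : U j * U j = (V j + dt * f (V j)) * U j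
     + (dt / r * (D / 2) * (INR j * ((U (j + 1)%nat - U j) * U j))
        + dt / r * d * (delta_z2 (mesh M) U j * U j))).
  { rewrite (step_solved j) at 1 by lia; rewrite Hz; ring. }
  assert (HY : (V j + dt * f (V j)) * U j
               <= g ^ 2 / 2 * (V j * V j) + 1 / 2 * (U j * U j)).
  { apply Rle_trans with (g * V j * U j).
    - apply Rmult_le_compat_r; [exact HU | unfold g; nra].
    - assert (H := pow2_ge_0 (g * V j - U j)); nra. }
  lra. }
rewrite !trap_plus, !trap_scal in Hsum; fold diff conv in Hsum.
assert (Hq : 0 < dt / r) by (apply Rdiv_lt_0_compat; assumption).
assert (dt / r * (D / 2) * conv <= 0).
{ assert (0 <= dt / r * (D / 2)) by (apply Rmult_le_pos; lra); nra. }
assert (dt / r * d * diff <= 0).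
{ assert (0 <= dt / r * d) by (apply Rmult_le_pos; lra); nra. }
set (SU := trap (M - 1) (fun j => U j * U j)) in *.
set (SV := trap (M - 1) (fun j => V j * V j)) in *.
replace (g ^ 2 * (mesh M * SV)) with (mesh M * (g ^ 2 * SV)) by ring.
apply Rmult_le_compat_l; lra.
Qed.

End OneStep.

(** * Iteration over the time levels *)

Lemma inner1_nonneg M u : (0 < M)%nat -> 0 <= inner1 M u u.
Proof.
intros HM; change (0 <= mesh M * trap (M - 1) (fun j => u j * u j)).
apply Rmult_le_pos; [apply Rlt_le, mesh_pos, HM |].
apply trap_nonneg; intros j _; apply Rle_0_sqr.
Qed.

Lemma pow_one_plus_le_exp x n : 0 <= x -> (1 + x) ^ n <= exp (INR n * x).
Proof.
intros Hx; induction n as [|n IH].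
- simpl; rewrite Rmult_0_l, exp_0; lra.
- rewrite S_INR.
  replace ((INR n + 1) * x) with (x + INR n * x) by ring.
  rewrite exp_plus; simpl.
  apply Rmult_le_compat; [lra | apply pow_le; lra | | exact IH].
  apply exp_ineq1_le.
Qed.

Lemma tstep_pos T N : 0 < T -> (0 < N)%nat -> 0 < tstep T N.
Proof. intros HT HN; apply Rdiv_lt_0_compat; [exact HT | apply lt_0_INR; exact HN]. Qed.

Lemma scheme_step_eq d mu h0 T f u0 M N W Rr n :
  scheme_S1 d mu h0 T f u0 M N W Rr -> (S n <= N)%nat ->
  step_eq d (tstep T N) (Rr (S n)) (delta_t (tstep T N) Rr (S n)) f M (W n) (W (S n)).
Proof.
intros HS Hn j Hj.
assert (Hn' : (1 <= S n <= N)%nat) by lia.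
destruct j as [|j].
- assert (E := S1_left _ _ _ _ _ _ _ _ _ _ HS (S n) Hn').
  unfold delta_t at 1 in E; replace (S n - 1)%nat with n in E by lia.
  rewrite <- E; unfold node; simpl INR; lra.
- assert (Hj' : (1 <= S j <= M - 1)%nat) by lia.
  assert (E := S1_inner _ _ _ _ _ _ _ _ _ _ HS (S n) (S j) Hn' Hj').
  unfold delta_t at 1 in E; replace (S n - 1)%nat with n in E by lia.
  exact E.
Qed.

(** With [W_M = 0], the front moves outwards as soon as [W_(M-1) >= 0]. *)
Lemma front_nondecreasing d mu h0 T f u0 M N W Rr n : 0 < mu -> (0 < M)%nat ->
  scheme_S1 d mu h0 T f u0 M N W Rr -> (S n <= N)%nat ->
  W n M = 0 -> (forall j, (j <= M)%nat -> 0 <= W n j) ->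
  0 <= delta_t (tstep T N) Rr (S n).
Proof.
intros Hmu HM HS Hn HWM HW.
assert (Hn' : (1 <= S n <= N)%nat) by lia.
rewrite (S1_front _ _ _ _ _ _ _ _ _ _ HS (S n) Hn').
replace (S n - 1)%nat with n by lia.
unfold delta_z; replace (M - 1 + 1)%nat with M by lia; rewrite HWM.
assert (H : 0 <= W n (M - 1)%nat / mesh M).
{ apply Rdiv_le_0_compat; [apply HW; lia | apply mesh_pos, HM]. }
replace (-2 * mu * ((0 - W n (M - 1)%nat) / mesh M))
  with (2 * mu * (W n (M - 1)%nat / mesh M)) by (unfold Rdiv; ring).
apply Rmult_le_pos; lra.
Qed.

(** The facts that have to be carried together through the time levels:
    positivity of [Rr n] and of [W n] feed each other, and the energy
    estimate uses both. *)
Lemma scheme_invariant d mu h0 T L f u0 M N W Rr :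
  0 < d -> 0 < mu -> 0 < h0 -> 0 < T -> 0 < L ->
  (forall u, 0 <= u -> - L * u <= f u <= L * u) ->
  (forall x, 0 <= x <= h0 -> 0 <= u0 x) -> u0 h0 = 0 ->
  (0 < M)%nat -> (0 < N)%nat -> L * tstep T N <= 1 ->
  scheme_S1 d mu h0 T f u0 M N W Rr ->
  forall n, (n <= N)%nat ->
    0 < Rr n /\ W n M = 0 /\ (forall j, (j <= M)%nat -> 0 <= W n j) /\
    inner1 M (W n) (W n) <= ((1 + L * tstep T N) ^ n) ^ 2 * inner1 M (W 0%nat) (W 0%nat).
Proof.
intros Hd Hmu Hh0 HT HL Hf Hu0 Hu0h HM HN Hdt HS n.
assert (Ht := tstep_pos T N HT HN).
assert (HM' : 0 < INR M) by (apply lt_0_INR; exact HM).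
induction n as [|n IH]; intros Hn.
- assert (HW0 := S1_W0 _ _ _ _ _ _ _ _ _ _ HS).
  split; [|split; [|split]].
  + rewrite (S1_R0 _ _ _ _ _ _ _ _ _ _ HS); apply pow_lt; exact Hh0.
  + rewrite HW0 by lia.
    replace (node M M * h0) with h0; [exact Hu0h | unfold node, mesh; field; lra].
  + intros j Hj; rewrite HW0 by exact Hj; apply Hu0.
    assert (H0 := node_nonneg M HM j).
    assert (H1 : node M j <= 1).
    { unfold node, mesh; apply le_INR in Hj.
      replace (INR j * (1 / INR M)) with (INR j / INR M) by (field; lra).
      apply Rle_div_l; lra. }
    nra.
  + simpl; lra.
- destruct IH as [HR [HWM [HW HE]]]; [lia|].
  assert (HD := front_nondecreasing _ _ _ _ _ _ _ _ _ _ _ Hmu HM HS Hn HWM HW).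
  assert (HR' : 0 < Rr (S n)).
  { assert (E : Rr (S n) = Rr n + tstep T N * delta_t (tstep T N) Rr (S n)).
    { unfold delta_t; replace (S n - 1)%nat with n by lia; field; lra. }
    rewrite E; nra. }
  assert (Hstep := scheme_step_eq _ _ _ _ _ _ _ _ _ _ n HS Hn).
  assert (HWM' : W (S n) M = 0) by (apply (S1_right _ _ _ _ _ _ _ _ _ _ HS); lia).
  assert (HW' : forall j, (j <= M)%nat -> 0 <= W (S n) j)
    by (apply (nonneg_step d (tstep T N) (Rr (S n))
      (delta_t (tstep T N) Rr (S n)) L f M (W n)); assumption).
  split; [exact HR' | split; [exact HWM' | split; [exact HW' |]]].
  apply Rle_trans with ((1 + L * tstep T N) ^ 2 * inner1 M (W n) (W n)).
  + apply (energy_step d (tstep T N) (Rr (S n))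
      (delta_t (tstep T N) Rr (S n)) L f M (W n)); assumption.
  + apply Rle_trans with ((1 + L * tstep T N) ^ 2 *
      (((1 + L * tstep T N) ^ n) ^ 2 * inner1 M (W 0%nat) (W 0%nat))).
    * apply Rmult_le_compat_l; [apply pow2_ge_0 | exact HE].
    * apply Req_le; simpl; ring.
Qed.

Theorem theorem3p4 (d mu h0 T L : R) (f u0 : R -> R)
  (hd : 0 < d) (hmu : 0 < mu) (hh0 : 0 < h0) (hT : 0 < T) (hL : 0 < L)
  (hf_diff : forall u : R, ex_derive f u)
  (hf_bound : forall u : R, 0 <= u -> - L * u <= f u <= L * u)
  (hf_deriv : forall u : R, 0 <= u -> Rabs (Derive f u) <= L)
  (hu0_C2 : C2_on 0 h0 u0)
  (hu0_deriv : D_in u0 (fun _ => 0) (Icc 0 h0) 0)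
  (hu0_right : u0 h0 = 0)
  (hu0_pos : forall x : R, 0 <= x < h0 -> 0 < u0 x) :
  exists C : R, 0 < C /\
    forall M N : nat, (0 < M)%nat -> (0 < N)%nat ->
      tstep T N < 1 / (2 * L) ->
      forall (W : nat -> nat -> R) (Rr : nat -> R),
        scheme_S1 d mu h0 T f u0 M N W Rr ->
        forall n : nat, (1 <= n <= N)%nat ->
          norm1 M (W n) <= C * norm1 M (W 0%nat).
Proof.
exists (exp (L * T)); split; [apply exp_pos|].
intros M N HM HN Hdt W Rr HS n [_ Hn].
assert (Ht := tstep_pos T N hT HN).
assert (HLdt : L * tstep T N <= 1).
{ assert (H : tstep T N * (2 * L) < 1) by (apply Rlt_div_r; [lra | exact Hdt]).
  assert (0 < L * tstep T N) by (apply Rmult_lt_0_compat; assumption); lra. }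
assert (Hu0 : forall x, 0 <= x <= h0 -> 0 <= u0 x).
{ intros x [Hx1 [Hx2 | ->]]; [apply Rlt_le, hu0_pos; lra | lra]. }
destruct (scheme_invariant d mu h0 T L f u0 M N W Rr hd hmu hh0 hT hL hf_bound
            Hu0 hu0_right HM HN HLdt HS n Hn) as [_ [_ [_ HE]]].
assert (Hx : 0 <= L * tstep T N) by (apply Rmult_le_pos; lra).
set (G := (1 + L * tstep T N) ^ n) in HE.
assert (HG0 : 0 <= G) by (apply pow_le; lra).
assert (HG : G <= exp (L * T)).
{ apply Rle_trans with ((1 + L * tstep T N) ^ N); [apply Rle_pow; [lra | exact Hn] |].
  apply Rle_trans with (1 := pow_one_plus_le_exp _ N Hx).
  replace (INR N * (L * tstep T N)) with (L * T); [lra|].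
  unfold tstep; field; apply not_0_INR; lia. }
unfold norm1.
apply Rle_trans with (G * sqrt (inner1 M (W 0%nat) (W 0%nat))).
- rewrite <- (sqrt_pow2 G HG0), <- sqrt_mult.
  + apply sqrt_le_1_alt; exact HE.
  + apply pow2_ge_0.
  + apply inner1_nonneg; exact HM.
- apply Rmult_le_compat_r; [apply sqrt_pos | exact HG].
Qed.
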